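(* Suppose $G=H\ltimes K$, where $G$, $H$ and $K$ are pattern groups (subgroups of $U_n$ for a common $n$, the semidirect product being internal with $K$ normal in $G$). If $(k-1)(h-1)=0$ for all $h\in H$ and $k\in K$, then $$\mathrm{SInd}_H^G(\chi)=\mathrm{Ind}_H^G(\chi)\qquad\text{for all superclass functions }\chi\text{ of }H.$$
   Context: $U_n$ is the group of $n\times n$ unipotent upper-triangular matrices over the finite field $\mathbb{F}_q$. For a partial order $\mathcal{P}$ on $\{1,\dots,n\}$, the pattern group is $$U_{\mathcal{P}}=\{u\in U_n\mid \text{for } i\neq j,\ u_{ij}\neq 0\text{ implies } i<j\text{ in }\mathcal{P}\}.$$ For a pattern group $G$, two elements $u,v\in G$ are in the same superclass of $G$ if $v-1=x(u-1)y$ for some $x,y\in G$. A superclass function of $G$ is a function $G\to\mathbb{C}$ constant on superclasses of $G$. For pattern groups $H\subseteq G$ and a function $\chi:H\to\mathbb{C}$ let $\dot\chi:G\to\mathbb{C}$ be $\dot\chi(z)=\chi(z)$ if $z\in H$ and $\dot\chi(z)=0$ if $z\notin H$. For a superclass function $\chi$ of $H$, superinduction is $$\mathrm{SInd}_H^G(\chi)(g)=\frac{1}{|G||H|}\sum_{x,y\in G}\dot\chi\big(x(g-1)y+1\big),\qquad g\in G,$$ and induction is the usual one, $\mathrm{Ind}_H^G(\chi)(g)=\frac{1}{|H|}\sum_{y\in G}\dot\chi(y^{-1}gy)$. *)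

(* Defs.v *)
From mathcomp Require Import all_boot all_order all_algebra all_fingroup.
From mathcomp.real_closed Require Import complex.
From mathcomp Require Import reals.

Set Implicit Arguments.
Unset Strict Implicit.
Unset Printing Implicit Defensive.

Import GRing.Theory.
Local Open Scope ring_scope.

Definition partial_order (T : Type) (P : rel T) : Prop :=
  [/\ reflexive P, antisymmetric P & transitive P].

Definition unitriangular (F : finFieldType) (n : nat) (u : 'M[F]_n) : bool :=
  [forall i : 'I_n, u i i == 1] &&
  [forall i : 'I_n, forall j : 'I_n, (j < i)%N ==> (u i j == 0)].

(* [P i j] is the non-strict order relation. [P] need not be compatible with
   the natural order of the indices; triangularity is required separately. *)
Definition pattern_set (F : finFieldType) (n : nat) (P : rel 'I_n.+1) :
    {set {'GL_n.+1[F]}} :=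
  [set u : {'GL_n.+1[F]} | unitriangular (GLval u) &&
    [forall i : 'I_n.+1, forall j : 'I_n.+1,
       (i != j) && (GLval u i j != 0) ==> P i j]].

(* Sets of this form are groups, so nothing is lost in asking a [{group _}] to
   be of this form. *)
Lemma pattern_set_group_set (F : finFieldType) (n : nat) (P : rel 'I_n.+1) :
  partial_order P -> group_set (pattern_set F P).
Proof.
case=> _ _ trP; apply/group_setP; split.
  rewrite inE; apply/andP; split; first (apply/andP; split).
  - by apply/forallP => i; rewrite GL_1E mxE eqxx.
  - apply/forallP => i; apply/forallP => j; apply/implyP => ji.
    by rewrite GL_1E mxE -val_eqE gtn_eqF.
  - apply/forallP => i; apply/forallP => j; apply/implyP => /andP[nij].
    by rewrite GL_1E mxE (negbTE nij) eqxx.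
move=> u v; rewrite !inE => /andP[/andP[u1 u0] uP] /andP[/andP[v1 v0] vP].
have {}u1 i : GLval u i i = 1 by apply/eqP/(forallP u1).
have {}v1 i : GLval v i i = 1 by apply/eqP/(forallP v1).
have {}u0 (i j : 'I_n.+1) : (j < i)%N -> GLval u i j = 0.
  by move=> ji; apply/eqP/(implyP (forallP (forallP u0 i) j)).
have {}v0 (i j : 'I_n.+1) : (j < i)%N -> GLval v i j = 0.
  by move=> ji; apply/eqP/(implyP (forallP (forallP v0 i) j)).
have {}uP (i j : 'I_n.+1) : i != j -> GLval u i j != 0 -> P i j.
  by move=> ij n0; apply: (implyP (forallP (forallP uP i) j)); rewrite ij.
have {}vP (i j : 'I_n.+1) : i != j -> GLval v i j != 0 -> P i j.
  by move=> ij n0; apply: (implyP (forallP (forallP vP i) j)); rewrite ij.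
rewrite /unitriangular GL_MxE; apply/andP; split; first (apply/andP; split).
- apply/forallP => i; rewrite mxE (bigD1 i) //= u1 v1 mulr1 big1 ?addr0 // => k.
  rewrite neq_ltn => /orP[ki|ik]; first by rewrite u0 ?mul0r.
  by rewrite v0 ?mulr0.
- apply/forallP => i; apply/forallP => j; apply/implyP => ji.
  rewrite mxE big1 // => k _; case: (ltnP k i) => [ki|ik].
    by rewrite u0 ?mul0r.
  by rewrite v0 ?mulr0 //; apply: leq_trans ik.
- apply/forallP => i; apply/forallP => j; apply/implyP => /andP[ij].
  apply: contraR => nP; rewrite mxE big1 // => k _; apply/eqP.
  apply: contraR nP; rewrite mulf_eq0 negb_or => /andP[uk vk].
  case: (eqVneq i k) => [ik|ik]; first by subst k; apply: vP.
  case: (eqVneq k j) => [kj|kj]; first by subst k; apply: uP.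
  exact: trP (uP _ _ ik uk) (vP _ _ kj vk).
Qed.

Definition is_pattern_group (F : finFieldType) (n : nat)
    (G : {group {'GL_n.+1[F]}}) : Prop :=
  exists2 P : rel 'I_n.+1, partial_order P & G :=: pattern_set F P.

Definition same_superclass (F : finFieldType) (n : nat)
    (G : {group {'GL_n.+1[F]}}) (u v : {'GL_n.+1[F]}) : Prop :=
  exists x y : {'GL_n.+1[F]}, [/\ x \in G, y \in G
    & GLval v - 1 = GLval x * (GLval u - 1) * GLval y].

(* Functions on a group [G] are encoded as functions on the whole linear group;
   only their values on [G] are ever used. *)
Definition superclass_function (F : finFieldType) (n : nat) (C : Type)
    (G : {group {'GL_n.+1[F]}}) (chi : {'GL_n.+1[F]} -> C) : Prop :=
  forall u v, u \in G -> v \in G -> same_superclass G u v -> chi u = chi v.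

(* The extension of [chi] by zero off [H], defined on all matrices because the
   argument [x (g - 1) y + 1] used in superinduction is given as a matrix. *)
Definition zero_extension (F : finFieldType) (n : nat) (C : nmodType)
    (H : {group {'GL_n.+1[F]}}) (chi : {'GL_n.+1[F]} -> C)
    (z : 'M[F]_n.+1) : C :=
  if (insub z : option {'GL_n.+1[F]}) is Some u
  then (if u \in H then chi u else 0) else 0.

Definition SInd (F : finFieldType) (n : nat) (C : fieldType)
    (G H : {group {'GL_n.+1[F]}}) (chi : {'GL_n.+1[F]} -> C)
    (g : {'GL_n.+1[F]}) : C :=
  (#|G|%:R * #|H|%:R)^-1 * \sum_(x in G) \sum_(y in G)
    zero_extension H chi (GLval x * (GLval g - 1) * GLval y + 1).

Definition Ind (F : finFieldType) (n : nat) (C : fieldType)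
    (G H : {group {'GL_n.+1[F]}}) (chi : {'GL_n.+1[F]} -> C)
    (g : {'GL_n.+1[F]}) : C :=
  #|H|%:R^-1 * \sum_(y in G) zero_extension H chi (GLval (y^-1 * g * y)%g).

(* Main.v *)
Require Import Defs.
From mathcomp Require Import all_boot all_order all_algebra all_fingroup.
From mathcomp Require Import reals.
From mathcomp.real_closed Require Import complex.

Import GRing.Theory Num.Theory.
Local Open Scope ring_scope.

(** Write [x = k a] and [g = l b] with [k, l] in [K] and [a, b] in [H].  Since
    [(K - 1)(H - 1) = 0], a product [k h] equals [(k - 1) + (h - 1) + 1], and
    [a (l - 1) = (l' - 1) a = l' - 1] with [l' = a l a^-1].  Hence
    [x (g - 1) + 1 = (1 + k (l' - 1)) (1 + a (b - 1))], where the two factors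
    lie in [K] and [H] because these are pattern groups.  This element is in
    [H] iff [l = 1], that is, iff [g] is in [H], and it is then in the
    superclass of [g].  So each term [x (g - 1) y + 1 = x y (g ^ y - 1) + 1] of
    the superinduction sum contributes the value of [chi] at [g ^ y]. *)

Lemma GLvalM (F : finFieldType) (n : nat) (u v : {'GL_n.+1[F]}) :
  GLval (u * v)%g = GLval u * GLval v.
Proof. by []. Qed.

Lemma GLval1 (F : finFieldType) (n : nat) :
  GLval (1%g : {'GL_n.+1[F]}) = 1.
Proof. by []. Qed.

Lemma unitriangularP (F : finFieldType) (n : nat) (u : 'M[F]_n) :
  reflect ((forall i, u i i = 1) /\ (forall i j : 'I_n, (j < i)%N -> u i j = 0))
          (unitriangular u).
Proof.
apply: (iffP andP) => -[u1 u0]; split.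
- by move=> i; apply/eqP/(forallP u1).
- by move=> i j ji; apply/eqP/(implyP (forallP (forallP u0 i) j)).
- by apply/forallP => i; rewrite u1.
- apply/forallP => i; apply/forallP => j.
  by apply/implyP => ji; rewrite u0.
Qed.

Lemma unitriangular_unitmx (F : finFieldType) (n : nat) (u : 'M[F]_n) :
  unitriangular u -> u \in unitmx.
Proof.
(* [det_trig] is about lower triangular matrices, hence the transpose. *)
case/unitriangularP => u1 u0; rewrite -unitmx_tr unitmxE det_trig.
  by rewrite big1 ?unitr1 // => i _; rewrite mxE u1.
by apply/is_trig_mxP => i j ij; rewrite mxE u0.
Qed.

Lemma pattern_groupP (F : finFieldType) (n : nat) (G : {group {'GL_n.+1[F]}}) :
  is_pattern_group G -> exists P : rel 'I_n.+1, forall u,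
    (u \in G) <-> unitriangular (GLval u) /\
      (forall i j, i != j -> ~~ P i j -> GLval u i j = 0).
Proof.
case=> P _ defG; exists P => u; rewrite defG inE.
split=> [/andP[uT uP]|[uT uP]].
  split=> // i j ij; apply: contraNeq => u0.
  by apply: (implyP (forallP (forallP uP i) j)); rewrite ij.
rewrite uT; apply/forallP => i; apply/forallP => j.
by apply/implyP => /andP[ij]; apply: contraNT => nP; rewrite uP.
Qed.

(** Since [a (b - 1) + 1 = a b - a + 1], each off-diagonal entry is a difference of entries of two
    members of [G], so it vanishes wherever the pattern requires, and each diagonal entry is
    [1 - 1 + 1]. *)
Lemma pattern_group_shift (F : finFieldType) (n : nat)
    (G : {group {'GL_n.+1[F]}}) (a b : {'GL_n.+1[F]}) :
  is_pattern_group G -> a \in G -> b \in G ->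
  exists2 c, c \in G & GLval c = GLval a * (GLval b - 1) + 1.
Proof.
move=> /pattern_groupP[P GP] aG bG.
have /GP[/unitriangularP[ab1 ab0] abP] := groupM aG bG.
have /GP[/unitriangularP[a1 a0] aP] := aG.
set M := GLval a * _ + 1.
have ME i j : M i j = GLval (a * b)%g i j - GLval a i j + (i == j)%:R.
  by rewrite /M mulrBr mulr1 GLvalM !mxE.
have MT : unitriangular M.
  apply/unitriangularP; split=> [i|i j ji].
    by rewrite ME ab1 a1 subrr add0r eqxx.
  by rewrite ME ab0 ?a0 // subrr add0r -val_eqE gtn_eqF.
have [c cE] : exists c : {'GL_n.+1[F]}, GLval c = M.
  by exists (FinRing.Unit (unitriangular_unitmx _ _ _ MT)).
exists c => //; apply/GP; rewrite cE.
split=> // i j ij nP.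
by rewrite ME abP ?aP // subrr add0r (negbTE ij).
Qed.

Lemma zero_extension_GLval (F : finFieldType) (n : nat) (C : nmodType)
    (H : {group {'GL_n.+1[F]}}) (chi : {'GL_n.+1[F]} -> C) (u : {'GL_n.+1[F]}) :
  zero_extension H chi (GLval u) = if u \in H then chi u else 0.
Proof. by rewrite /zero_extension valK. Qed.

Lemma zero_extension_lmul (F : finFieldType) (n : nat) (C : nmodType)
    (G H K : {group {'GL_n.+1[F]}}) (chi : {'GL_n.+1[F]} -> C)
    (hH : is_pattern_group H) (hK : is_pattern_group K)
    (hGHK : (K ><| H)%g = G)
    (hKH : forall h k : {'GL_n.+1[F]}, h \in H -> k \in K ->
      (GLval k - 1) * (GLval h - 1) = 0)
    (hchi : superclass_function H chi) (x g : {'GL_n.+1[F]}) :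
  x \in G -> g \in G ->
  zero_extension H chi (GLval x * (GLval g - 1) + 1)
    = zero_extension H chi (GLval g).
Proof.
have [_ defG nKH tiKH] := sdprodP hGHK.
have KH1 k : k \in H -> k \in K -> k = 1%g.
  by move=> kH kK; apply/set1P; rewrite -[[set _]]tiKH inE kK.
have mulKH h k : h \in H -> k \in K ->
    GLval (k * h)%g = (GLval k - 1) + GLval h.
  move=> hh kk; have /eqP := hKH h k hh kk.
  by rewrite mulrBr mulr1 mulrBl mul1r subr_eq0 subr_eq -GLvalM => /eqP.
rewrite -defG => /mulsgP[k a kK aH ->] /mulsgP[l b lK bH ->].
pose l' := (l ^ a^-1)%g.
have l'K : l' \in K by rewrite memJ_norm // groupV (subsetP nKH).
(* From [a l = l' a] and [l' a = (l' - 1) + a], subtracting [a]. *)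
have al : GLval a * (GLval l - 1) = GLval l' - 1.
  have e : (a * l = l' * a)%g by rewrite /l' conjgE invgK mulgA mulgKV.
  by rewrite mulrBr mulr1 -GLvalM e mulKH // addrK.
have [h hh hE] := pattern_group_shift _ _ H a b hH aH bH.
have [k' kk' kE] := pattern_group_shift _ _ K k l' hK kK l'K.
have -> : GLval (k * a)%g * (GLval (l * b)%g - 1) + 1 = GLval (k' * h)%g.
  (* Here [k a = (k - 1) + a], and [k - 1] annihilates [b - 1]. *)
  have kab : GLval (k * a)%g * (GLval b - 1) = GLval a * (GLval b - 1).
    by rewrite mulKH // mulrDl hKH // add0r.
  rewrite (mulKH _ _ hh kk') (mulKH _ _ bH lK) kE hE addrK -addrA mulrDr kab.
  by rewrite GLvalM -mulrA al addrA.
rewrite !zero_extension_GLval !groupMr //.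
have k'1 : l = 1%g -> k' = 1%g.
  by move=> l1; apply: val_inj; rewrite /= kE /l' l1 conj1g subrr mulr0 add0r.
(* As [K] meets [H] trivially, both sides say that the element is 1. If [k' = 1] then
   [k (l' - 1) = 0], and [k] is invertible, so [l'] and its conjugate [l] are trivial. *)
have -> : (k' \in H) = (l \in H).
  apply/idP/idP => [/KH1 /(_ kk') k'_1|/KH1 /(_ lK)/k'1->]; last exact: group1.
  have kl0 : GLval k * (GLval l' - 1) = 0.
    by rewrite -[LHS](addrK 1) -kE k'_1 GLval1 subrr.
  have l'1 : l' = 1%g.
    apply: val_inj; apply/eqP; rewrite -subr_eq0; apply/eqP.
    by apply: (mulrI (GL_unit k)); rewrite mulr0; exact: kl0.
  by move/eqP: l'1; rewrite conjg_eq1 => /eqP->; rewrite group1.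
case: ifP => // /KH1 /(_ lK) l1.
rewrite k'1 // l1 !mul1g; apply/esym/hchi => //.
(* Now [g = b], and [h - 1 = a (b - 1)] by the choice of [h]. *)
by exists a, 1%g; rewrite group1 hE addrK GLval1 mulr1.
Qed.

Theorem theorem3p2 (R : realType) (F : finFieldType) (n : nat)
    (G H K : {group {'GL_n.+1[F]}})
    (hG : is_pattern_group G) (hH : is_pattern_group H)
    (hK : is_pattern_group K) (hGHK : (K ><| H)%g = G)
    (hKH : forall h k : {'GL_n.+1[F]}, h \in H -> k \in K ->
      (GLval k - 1) * (GLval h - 1) = 0)
    (chi : {'GL_n.+1[F]} -> R[i]) (hchi : superclass_function H chi) :
  forall g : {'GL_n.+1[F]}, g \in G -> SInd G H chi g = Ind G H chi g.
Proof.
move=> g gG; rewrite /SInd /Ind exchange_big.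
rewrite (eq_bigr (fun y =>
    #|G|%:R * zero_extension H chi (GLval (y^-1 * g * y)%g))); last first.
  (* Replacing [x] by [x y^-1] turns the argument into [x (g ^ y - 1) + 1], whose value does not
     depend on [x]; the inner sum is thus [#|G|] equal terms. *)
  move=> y yG; rewrite (reindex_inj (mulIg y^-1%g)).
  under eq_bigl => x do rewrite groupMr ?groupV //.
  have gyG : (y^-1 * g * y)%g \in G by rewrite !groupM ?groupV.
  rewrite mulr_natl -sumr_const; apply: eq_bigr => x xG.
  have := zero_extension_lmul _ _ _ _ _ _ _ hH hK hGHK hKH hchi _ _ xG gyG.
  move=> <-; congr (zero_extension _ _ (_ + 1)).
  by rewrite !mulrBr !mulrBl !mulr1 -!GLvalM mulgKV !mulgA.
rewrite -mulr_sumr mulrA; congr (_ * _); rewrite invfM mulrAC mulVf ?mul1r //.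
by rewrite pnatr_eq0 -lt0n cardG_gt0.
Qed.
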